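(* Let $S:[0,\infty)\to[0,\infty]$ be a non-decreasing function with $S(0)=0$, and consider the min-plus linear system with exact service curve $S$, i.e. the system in which every arrival function $A$ produces the departure function $D=A*S$. For $r\ge 0$ let $$B_{\max}(r)=\sup_{t\ge 0}\{A_r(t)-D_r(t)\}$$ be the maximum backlog for the constant-rate arrival function $A_r(t)=rt$, where $D_r=A_r*S$. Then: (i) $B_{\max}(r)=\sup_{t\ge 0}\{rt-S(t)\}=\mathcal{L}_S(r)$ for all $r\ge 0$; (ii) if $S$ is convex, then $S$ is completely recovered from the maximum backlogs: $$S(t)=\mathcal{L}(\mathcal{L}_S)(t)=\mathcal{L}_{B_{\max}}(t)=\sup_{r\ge 0}\{rt-B_{\max}(r)\}\qquad\text{for all } t\ge 0;$$ (iii) if $S$ is not convex, then $\mathcal{L}_{B_{\max}}$ is a lower bound for the service curve: $\mathcal{L}_{B_{\max}}(t)=\sup_{r\ge 0}\{rt-B_{\max}(r)\}\le S(t)$ for all $t\ge 0$.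
   Context: Arrival functions are non-decreasing functions $A:[0,\infty)\to[0,\infty]$ with $A(0)=0$. For functions $f,g:[0,\infty)\to[0,\infty]$, the min-plus convolution is $(f*g)(t)=\inf_{0\le\tau\le t}\{f(\tau)+g(t-\tau)\}$ for $t\ge 0$. The Legendre transform of $f:[0,\infty)\to[0,\infty]$ is $\mathcal{L}_f(r)=\mathcal{L}(f)(r)=\sup_{\tau\ge 0}\{r\tau-f(\tau)\}$ for $r\ge 0$, with $x-\infty=-\infty$ for finite $x$. The same formula is applied to functions of the rate variable $r\ge 0$, giving functions of $t\ge 0$.
   Formalization: In (ii), S(t)=L(L_S)(t) is claimed only where S is left-continuous at t if t>0 and S=+∞ on all of (t,∞); without this it fails, e.g. for S=0 on [0,1), S=+∞ on [1,∞) at t=1. For finite-valued S nothing is added. *)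

(* Defs.v *)
From HB Require Import structures.
From mathcomp Require Import all_boot all_order all_algebra.
From mathcomp Require Import all_classical all_reals all_analysis.

Set Implicit Arguments.
Unset Strict Implicit.
Unset Printing Implicit Defensive.

Import Order.TTheory GRing.Theory Num.Theory.
Import numFieldNormedType.Exports.

Local Open Scope classical_set_scope.
Local Open Scope ring_scope.
Local Open Scope ereal_scope.

(* Functions on [0, +oo[ with extended-real values are represented by functions
   R -> \bar R; no definition below looks at their values at negative reals,
   so these values are irrelevant. *)

(* Non-decreasing functions [0, +oo[ -> [0, +oo] vanishing at 0: both the
   arrival functions and the service curves. *)
Definition wide_sense_increasing (R : realType) (f : R -> \bar R) : Prop :=
  [/\ f 0%R = 0,
      forall t : R, (0 <= t)%R -> 0 <= f t &
      forall s t : R, (0 <= s)%R -> (s <= t)%R -> f s <= f t].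

Definition minplus_conv (R : realType) (f g : R -> \bar R) (t : R) : \bar R :=
  ereal_inf [set f tau + g (t - tau)%R | tau in [set tau : R | (0 <= tau <= t)%R]].

Definition legendre (R : realType) (f : R -> \bar R) (r : R) : \bar R :=
  ereal_sup [set (r * tau)%:E - f tau | tau in [set tau : R | (0 <= tau)%R]].

(* A system maps each arrival function to a departure function. *)
Definition exact_service_curve (R : realType)
    (sys : (R -> \bar R) -> (R -> \bar R)) (S : R -> \bar R) : Prop :=
  forall A : R -> \bar R, wide_sense_increasing A ->
  forall t : R, (0 <= t)%R -> sys A t = minplus_conv A S t.

Definition constant_rate (R : realType) (r : R) : R -> \bar R :=
  fun t : R => (r * t)%:E.

Definition max_backlog (R : realType) (sys : (R -> \bar R) -> (R -> \bar R))
    (r : R) : \bar R :=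
  ereal_sup [set constant_rate r t - sys (constant_rate r) t
            | t in [set t : R | (0 <= t)%R]].

(* The library's convex_function only covers finite-valued functions. The
   weights are taken in ]0, 1[ so that no product 0 * +oo occurs. *)
Definition econvex (R : realType) (f : R -> \bar R) : Prop :=
  forall s t lam : R, (0 <= s)%R -> (0 <= t)%R -> (0 < lam < 1)%R ->
  f (lam * s + (1 - lam) * t)%R <= lam%:E * f s + (1 - lam)%:E * f t.

(* Left-continuity at t, required only if t > 0 and f is infinite everywhere
   after t; it is vacuous at every t when f is finite-valued. A convex
   nondecreasing f that violates it (at the right end of its effective domain)
   is not lower semicontinuous, hence differs from its biconjugate: for instance
   f = 0 on [0, 1[ and f = +oo on [1, +oo[, whose biconjugate is 0 at 1. *)
Definition closed_at_edge (R : realType) (f : R -> \bar R) (t : R) : Prop :=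
  (0 < t)%R -> (forall u : R, (t < u)%R -> f u = +oo) -> f u @[u --> t^'-] --> f t.

(* Main.v *)
Require Import Defs.
From HB Require Import structures.
From mathcomp Require Import all_boot all_order all_algebra.
From mathcomp Require Import all_classical all_reals all_analysis.
From mathcomp Require Import ring lra.

Import Order.TTheory GRing.Theory Num.Theory.
Import numFieldNormedType.Exports.

Set Implicit Arguments.
Unset Strict Implicit.
Unset Printing Implicit Defensive.

Local Open Scope classical_set_scope.
Local Open Scope ring_scope.
Local Open Scope ereal_scope.

(* Points strictly below the graph of [S] lie under some line of slope [r >= 0]
   staying below [S], and each such line is detected by the biconjugate. At an
   interior point of the effective domain of a convex [S] the slope is the left
   derivative. At the right end [t] of the effective domain, closedness gives
   [s < t] with [c < S s]; by monotonicity any slope at least [c / (t - s)] works. *)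

Lemma wide_sense_increasing_constant_rate (R : realType) (r : R) :
  (0 <= r)%R -> wide_sense_increasing (constant_rate r).
Proof.
move=> r0; rewrite /constant_rate; split; first by rewrite mulr0.
- by move=> t t0; rewrite lee_fin mulr_ge0.
- by move=> s t s0 st; rewrite lee_fin ler_wpM2l.
Qed.

Lemma legendreC (R : realType) (f : R -> \bar R) (r : R) :
  legendre f r
    = ereal_sup [set (t * r)%:E - f t | t in [set t : R | (0 <= t)%R]].
Proof. by congr ereal_sup; apply: eq_imagel => t _; rewrite mulrC. Qed.

Lemma le_legendreP (R : realType) (f : R -> \bar R) (r : R) (b : \bar R) :
  legendre f r <= b <-> forall t, (0 <= t)%R -> (r * t)%:E - f t <= b.
Proof.
split=> [fb t t0|fb]; last by apply: ge_ereal_sup => _ [t /= t0 <-]; exact: fb.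
by apply: le_trans fb; apply: ereal_sup_ubound; exists t.
Qed.

Lemma legendre_ubound (R : realType) (f : R -> \bar R) (r t : R) :
  (0 <= t)%R -> (r * t)%:E - f t <= legendre f r.
Proof. by move=> t0; apply: (proj1 (le_legendreP _ _ _)). Qed.

(** The backlog identity is available only at nonnegative rates; this lets it be substituted under a
    second transform. *)
Lemma eq_legendre (R : realType) (f g : R -> \bar R) (t : R) :
  (forall r, (0 <= r)%R -> f r = g r) -> legendre f t = legendre g t.
Proof.
move=> fg; apply/eqP; rewrite eq_le; apply/andP; split; apply/le_legendreP => r r0.
  by rewrite fg//; exact: legendre_ubound.
by rewrite -fg//; exact: legendre_ubound.
Qed.

Lemma legendre_ge0 (R : realType) (f : R -> \bar R) (r : R) :
  f 0%R = 0 -> 0 <= legendre f r.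
Proof.
by move=> f0; have := legendre_ubound f r (lexx 0%R); rewrite f0 mulr0 sube0.
Qed.

(** Lets [legendre_ge0] be applied to [legendre f] itself, so that the biconjugate is
    nonnegative. *)
Lemma legendre_at0 (R : realType) (f : R -> \bar R) :
  wide_sense_increasing f -> legendre f 0%R = 0.
Proof.
move=> [f0 fge0 _]; apply/eqP; rewrite eq_le legendre_ge0// andbT.
by apply/le_legendreP => t t0; rewrite mul0r add0e oppe_le0 fge0.
Qed.

(** For the upper bound, with [l] the transform at [r], [S (t - u) >= r (t - u) - l] gives
    [r u + S (t - u) >= r t - l] for every split point [u]. For the lower bound, the split point 0
    shows that the departures at [t] are at most [S t]. *)
Lemma max_backlogE (R : realType) (S : R -> \bar R)
    (sys : (R -> \bar R) -> (R -> \bar R)) (r : R) :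
  wide_sense_increasing S -> exact_service_curve sys S -> (0 <= r)%R ->
  max_backlog sys r = legendre S r.
Proof.
move=> [S0 Sge0 _] sysS r0.
have sysE t : (0 <= t)%R -> sys (constant_rate r) t = minplus_conv (constant_rate r) S t.
  by move=> t0; apply: sysS => //; exact: wide_sense_increasing_constant_rate.
apply/eqP; rewrite eq_le; apply/andP; split.
  apply: ge_ereal_sup => _ [t /= t0 <-]; rewrite sysE// /constant_rate.
  have := legendre_ge0 r S0; have := @legendre_ubound _ S r.
  (* Nonnegativity of the transform excludes [-oo]. *)
  case: (legendre S r) => [l| |]// Sl _; last by rewrite leey.
  have : (r * t - l)%:E <= minplus_conv (constant_rate r) S t.
    apply: le_ereal_inf_tmp => _ [u /andP[u0 ut] <-].
    have tu0 : (0 <= t - u)%R by rewrite subr_ge0.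
    have := Sl _ tu0; have := Sge0 _ tu0; rewrite /constant_rate.
    case: (S (t - u)%R) => [x| |]//= _; last by rewrite leey.
    by rewrite -EFinB -EFinD !lee_fin mulrBr; lra.
  rewrite -/(constant_rate r); case: (minplus_conv _ _ _) => [d| |]//=.
    by rewrite -EFinB !lee_fin; lra.
  by rewrite leNye.
apply/le_legendreP => t t0.
apply: (@le_trans _ _ (constant_rate r t - sys (constant_rate r) t)).
  rewrite /constant_rate leeB// sysE//; apply: ereal_inf_lbound.
  by exists 0%R; [rewrite /= lexx|rewrite /constant_rate mulr0 add0e subr0].
by apply: ereal_sup_ubound; exists t.
Qed.

(** Young's inequality [r t - f t <= legendre f r], rearranged for each [r]. *)
Lemma legendre_legendre_le (R : realType) (f : R -> \bar R) (t : R) :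
  (0 <= t)%R -> 0 <= f t -> legendre (legendre f) t <= f t.
Proof.
move=> t0 ft0; apply/le_legendreP => r r0.
have := legendre_ubound f r t0; move: ft0.
case: (f t) => [x| |]// _; last by rewrite leey.
case: (legendre f r) => [l| |]//= ; last by rewrite leNye.
by rewrite -!EFinB !lee_fin mulrC; lra.
Qed.

(** The minorant says exactly that [legendre f r <= r t - c], so the term of slope [r] in the
    biconjugate at [t] is already at least [c]. *)
Lemma affine_minorant_le_legendre_legendre (R : realType) (f : R -> \bar R)
    (r t c : R) :
  (0 <= r)%R -> (forall u, (0 <= u)%R -> (c + r * (u - t))%:E <= f u) ->
  c%:E <= legendre (legendre f) t.
Proof.
move=> r0 cf; apply: le_trans (legendre_ubound (legendre f) t r0).
have : legendre f r <= (r * t - c)%:E.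
  apply/le_legendreP => u u0; have := cf u u0.
  case: (f u) => [x| |]//; last by rewrite leNye.
  by rewrite -!EFinB !lee_fin mulrBr; lra.
case: (legendre f r) => [l| |]//=; last by rewrite leey.
by rewrite -!EFinB !lee_fin mulrC; lra.
Qed.

Lemma econvex_three_slopes (R : realType) (f : R -> \bar R) (s t u a b c : R) :
  econvex f -> (0 <= s)%R -> (s < t)%R -> (t < u)%R ->
  f s = a%:E -> f t = b%:E -> f u = c%:E ->
  ((b - a) / (t - s) <= (c - b) / (u - t))%R.
Proof.
move=> fconv s0 st tu fs ft fu.
have us : (0 < u - s)%R by lra.
have us0 := lt0r_neq0 us.
(* The weight for which [t] is the convex combination of [s] and [u]. *)
pose lam := ((u - t) / (u - s))%R.
have lam01 : (0 < lam < 1)%R.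
  apply/andP; split; first by rewrite divr_gt0// subr_gt0.
  by rewrite ltr_pdivrMr// mul1r ltrD2l ltrN2.
have u0 : (0 <= u)%R by lra.
have := fconv s u lam s0 u0 lam01.
have -> : (lam * s + (1 - lam) * u = t)%R by rewrite /lam; field.
rewrite fs ft fu -!EFinM -EFinD lee_fin => /(ler_wpM2r (ltW us)).
have -> : ((lam * a + (1 - lam) * c) * (u - s) = (u - t) * a + (t - s) * c)%R.
  by rewrite /lam; field.
(* [H] is the slope inequality with denominators cleared, up to regrouping [u - s] as
   [(u - t) + (t - s)]. *)
move=> H; rewrite ler_pdivrMr ?subr_gt0// mulrAC ler_pdivlMr ?subr_gt0//.
by nra.
Qed.

(** The slope is the supremum of the left chord slopes at [t]. Every finite right chord slope bounds
    them above, and [v] supplies one, so the supremum is finite. Left of [t] the line lies below [f]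
    because the supremum is an upper bound, right of [t] because it is the least one. *)
Lemma econvex_affine_minorant (R : realType) (f : R -> \bar R) (t v : R) :
  wide_sense_increasing f -> econvex f -> (0 < t)%R -> (t < v)%R ->
  f v != +oo -> f t \is a fin_num /\ exists2 r : R, (0 <= r)%R &
    forall u, (0 <= u)%R -> (fine (f t) + r * (u - t))%:E <= f u.
Proof.
move=> [f0 fge0 fmon] fconv t0 tv fv.
have fin u : (0 <= u)%R -> f u != +oo -> f u = (fine (f u))%:E.
  by move=> u0 fu; rewrite fineK// ge0_fin_numE ?fge0// ltey.
have v0 : (0 <= v)%R by lra.
have finle u : (0 <= u)%R -> (u <= v)%R -> f u = (fine (f u))%:E.
  move=> u0 uv; apply: fin => //; rewrite -ltey.
  by apply: le_lt_trans (fmon _ _ u0 uv) _; rewrite ltey.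
have ft := finle t (ltW t0) (ltW tv).
split; first by rewrite ft.
pose slope s := ((fine (f t) - fine (f s)) / (t - s))%R.
pose E := [set slope s | s in [set s : R | (0 <= s < t)%R]].
have slope_le u : (t < u)%R -> f u != +oo ->
    ubound E ((fine (f u) - fine (f t)) / (u - t))%R.
  move=> tu fu _ [s /andP[s0 st] <-]; rewrite /slope.
  apply: (econvex_three_slopes fconv s0 st tu) => //.
    by apply: finle => //; lra.
  by apply: fin => //; lra.
have E0 : E (slope 0%R) by exists 0%R; rewrite //= lexx.
have supE : has_sup E.
  split; [by exists (slope 0%R)|by exists ((fine (f v) - fine (f t)) / (v - t))%R; exact: slope_le].
exists (sup E).
  (* The chord from the origin has slope [f t / t], which is nonnegative. *)
  apply: le_trans (ub_le_sup supE.2 E0); rewrite /slope f0 /= !subr0.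
  by rewrite divr_ge0 ?(ltW t0)// fine_ge0// fge0// ltW.
move=> u u0; have [ut|tu|->] := ltgtP u t.
- rewrite (finle u)//; last by lra.
  have Eu : E (slope u) by exists u => //=; rewrite u0.
  have := ub_le_sup supE.2 Eu; rewrite /slope ler_pdivrMr ?subr_gt0// lee_fin; nra.
- have [->|fu] := eqVneq (f u) +oo; first by rewrite leey.
  have := ge_sup supE.1 (slope_le u tu fu); rewrite ler_pdivlMr ?subr_gt0//.
  by rewrite (fin u)// lee_fin /=; lra.
- by rewrite subrr mulr0 addr0 -ft.
Qed.

Lemma edge_affine_minorant (R : realType) (f : R -> \bar R) (t c : R) :
  wide_sense_increasing f -> closed_at_edge f t -> (0 < t)%R ->
  (forall u, (t < u)%R -> f u = +oo) -> (0 <= c)%R -> c%:E < f t ->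
  exists2 r : R, (0 <= r)%R &
    forall u, (0 <= u)%R -> (c + r * (u - t))%:E <= f u.
Proof.
move=> [_ fge0 fmon] fcl t0 fy c0 cft.
have near_t : \forall u \near t^'-, c%:E < f u.
  apply: (fcl t0 fy [set y | c%:E < y]).
  by apply: open_nbhs_nbhs; split => //; exact: open_ereal_gt_ereal.
have [s [st [s0 cs]]] : exists s, (s < t /\ 0 < s /\ (c%:E < f s)%E)%R.
  apply: (@filter_ex _ t^'-); apply: filterI (nbhs_left_lt t) _.
  by apply: filterI near_t; exact: nbhs_left_gt.
have ts : (0 < t - s)%R by rewrite subr_gt0.
have r0 := divr_ge0 c0 (ltW ts).
(* The line through [(t, c)] that vanishes at [s]: it is at most 0 before [s], and at most [c < f s]
   between [s] and [t]. *)
exists (c / (t - s))%R => // u u0.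
have [tu|ut] := ltP t u; first by rewrite fy ?leey.
have [us|su] := ltP u s.
  apply: le_trans (fge0 u u0); rewrite lee_fin.
  have : (c / (t - s) * (t - s) <= c / (t - s) * (t - u))%R.
    by rewrite ler_wpM2l// lerD2l lerN2 ltW.
  by rewrite divfK ?lt0r_neq0//; lra.
apply: le_trans (fmon _ _ (ltW s0) su); apply: le_trans (ltW cs).
by rewrite lee_fin gerDl mulr_ge0_le0// subr_le0.
Qed.

Lemma le_legendre_legendre (R : realType) (f : R -> \bar R) (t : R) :
  wide_sense_increasing f -> econvex f -> (0 <= t)%R -> closed_at_edge f t ->
  f t <= legendre (legendre f) t.
Proof.
move=> finc fconv; rewrite le_eqVlt => /orP[/eqP<-|t0] fcl.
  by have [-> _ _] := finc; rewrite legendre_ge0// legendre_at0.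
have [fy|] := pselect (forall u, (t < u)%R -> f u = +oo); last first.
  move=> /existsNP[v /not_implyP[tv /eqP fv]].
  have [ft [r r0 fr]] := econvex_affine_minorant finc fconv t0 tv fv.
  by rewrite -(fineK ft); exact: affine_minorant_le_legendre_legendre fr.
have LL0 : 0 <= legendre (legendre f) t by rewrite legendre_ge0// legendre_at0.
rewrite leNgt; apply/negP => LLf.
(* At the edge [f t] may be [+oo] or approached by no single line, so a real height strictly below
   it is used; it is nonnegative because the biconjugate is. *)
have [c c0 /andP[LLc cf]] : exists2 c : R, (0 <= c)%R &
    legendre (legendre f) t < c%:E < f t.
  move: LL0 LLf; case: (legendre _ _) => [x| |]//; case: (f t) => [y| |]//.
    by rewrite lee_fin lte_fin => x0 xy; exists ((x + y) / 2)%R; rewrite ?lte_fin; lra.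
  by rewrite lee_fin => x0 _; exists (x + 1)%R; rewrite ?ltry ?lte_fin ?ltrDl ?addr_ge0// ltr01.
have [r r0 cr] := edge_affine_minorant finc fcl t0 fy c0 cf.
by have := affine_minorant_le_legendre_legendre r0 cr; rewrite leNgt LLc.
Qed.

Theorem mainTheorem3 (R : realType) (S : R -> \bar R)
    (sys : (R -> \bar R) -> (R -> \bar R))
    (S_incr : wide_sense_increasing S)
    (sys_S : exact_service_curve sys S) :
  [/\ (* (i) *)
      forall r : R, (0 <= r)%R ->
        max_backlog sys r
          = ereal_sup [set (r * t)%:E - S t | t in [set t : R | (0 <= t)%R]]
        /\ ereal_sup [set (r * t)%:E - S t | t in [set t : R | (0 <= t)%R]]
          = legendre S r,
      (* (ii) *)
      econvex S -> forall t : R, (0 <= t)%R ->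
        [/\ closed_at_edge S t -> S t = legendre (legendre S) t,
            legendre (legendre S) t = legendre (max_backlog sys) t &
            legendre (max_backlog sys) t
              = ereal_sup [set (r * t)%:E - max_backlog sys r
                          | r in [set r : R | (0 <= r)%R]]]
    & (* (iii) *)
      ~ econvex S -> forall t : R, (0 <= t)%R ->
        legendre (max_backlog sys) t
          = ereal_sup [set (r * t)%:E - max_backlog sys r
                      | r in [set r : R | (0 <= r)%R]]
        /\ legendre (max_backlog sys) t <= S t].
Proof.
have S_ge0 t : (0 <= t)%R -> 0 <= S t by case: S_incr => _ + _; apply.
have backlogE r : (0 <= r)%R -> max_backlog sys r = legendre S r.
  exact: max_backlogE S_incr sys_S.
split.
- by move=> r /backlogE ->.
- move=> S_conv t t0; split; last exact: legendreC.
  + move=> S_closed; apply/eqP; rewrite eq_le le_legendre_legendre//=.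
    by rewrite legendre_legendre_le ?S_ge0.
  (* The two functions agree at all nonnegative rates by [backlogE]. *)
  + by apply/esym/eq_legendre.
- move=> _ t t0; split; first exact: legendreC.
  by rewrite (eq_legendre _ backlogE) legendre_legendre_le ?S_ge0.
Qed.
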